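(* Let $A\in\mathbb{R}^{n\times n}$ be positive definite, $b\in\mathbb{R}^n$, and let $m$ be a nonnegative integer. If $$\lambda_{\min}(\mathcal{H}_{A^{-1}})>\rho(\mathcal{S}_{A^{-1}}),$$ then the sequence $\{x_k\}$ produced by SWI (with window parameter $m$) converges to the unique solution $x_\star$ of $Ax=b$ (where, if $r_k=0$ for some $k$, SWI stops with $x_k=x_\star$).
   Context: A real square (not necessarily symmetric) matrix $A$ is positive definite if $x^TAx>0$ for all nonzero $x\in\mathbb{R}^n$. For a real square matrix $W$, $\mathcal{H}_W=(W+W^T)/2$ and $\mathcal{S}_W=(W-W^T)/2$ are its symmetric and skew-symmetric parts; $\rho(\cdot)$ is the spectral radius and $\lambda_{\min}(\cdot)$ the smallest eigenvalue of a symmetric matrix. SWI (sliding window implementation of the semi-conjugate gradient method), in exact arithmetic, with a nonnegative integer $m$. Set $x_0=0$, $r_0=b$, $p_0=r_0$, $q_0=Ap_0$. For $k=0,1,2,\dots$: compute $\alpha_k=r_k^Tp_k/(p_k^Tq_k)$, $x_{k+1}=x_k+\alpha_kp_k$, $r_{k+1}=r_k-\alpha_kq_k$; let $m_k=\min\{k,m\}$, form $v_{k+1}=Ar_{k+1}$, $P_{k+1}=[p_{k-m_k}\ \cdots\ p_k]$, $Q_{k+1}=[q_{k-m_k}\ \cdots\ q_k]$, $L_{k+1}=P_{k+1}^TQ_{k+1}$, solve $L_{k+1}\lambda_{k+1}=P_{k+1}^Tv_{k+1}$ and set $p_{k+1}=r_{k+1}-P_{k+1}\lambda_{k+1}$,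 $q_{k+1}=v_{k+1}-Q_{k+1}\lambda_{k+1}$. The method stops as soon as $r_k=0$. *)

(* Defs.v *)
From HB Require Import structures.
From mathcomp Require Import all_boot all_order all_algebra.
From mathcomp Require Import all_classical all_reals all_analysis.
From mathcomp Require Import complex.
Import Order.TTheory GRing.Theory Num.Theory.
Import numFieldNormedType.Exports.

Set Implicit Arguments.
Unset Strict Implicit.
Unset Printing Implicit Defensive.

Local Open Scope classical_set_scope.
Local Open Scope ring_scope.

Section Matrices.
Variables (R : realType) (n : nat).
Implicit Types A W : 'M[R]_n.

(* Symmetry of A is not required. *)
Definition posdefmx A : Prop :=
  forall x : 'cV[R]_n, x != 0 -> 0 < (x^T *m A *m x) 0 0.

Definition sym_part W : 'M[R]_n := 2^-1 *: (W + W^T).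

Definition skew_part W : 'M[R]_n := 2^-1 *: (W - W^T).

(* Moduli of all the complex eigenvalues; for 0 < n the set is finite and
   nonempty, so its supremum is a maximum. *)
Definition spectral_radius W : R :=
  sup [set ComplexField.Normc.normc z | z in
        [set z : complex R |
          eigenvalue (map_mx (real_complex R) W) z]].

(* For 0 < n and W symmetric the set is finite and nonempty, so its infimum is
   the smallest eigenvalue. *)
Definition lambda_min W : R := inf [set a : R | eigenvalue W a].

End Matrices.

Section SlidingWindow.
Variables (R : realType) (n : nat).

(* State at the beginning of step k. Only the entries p_0 .. p_k and q_0 .. q_k
   of the two tables are meaningful; the others are never read. *)
Record swi_state := SwiState {
  swi_x : 'cV[R]_n;
  swi_r : 'cV[R]_n;
  swi_p : nat -> 'cV[R]_n;
  swi_q : nat -> 'cV[R]_n }.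

Variables (A : 'M[R]_n) (b : 'cV[R]_n) (m : nat).

Definition dot (u v : 'cV[R]_n) : R := (u^T *m v) 0 0.

(* [ u_(k - m_k) ... u_k ] with m_k = min(k, m). *)
Definition window (u : nat -> 'cV[R]_n) (k : nat) : 'M[R]_(n, (minn k m).+1) :=
  \matrix_(i, j) u (k - minn k m + j)%N i 0.

Definition swi_init : swi_state :=
  SwiState 0 b (fun=> b) (fun=> A *m b).

(* Stopping at r_k = 0 is rendered by a stationary state. For A positive
   definite and r_k != 0, p_k^T q_k is nonzero and L is invertible (it is lower
   triangular with diagonal entries p_j^T A p_j and p_j != 0), so that the
   default values of the total operations / and invmx are not used. *)
Definition swi_step (k : nat) (s : swi_state) : swi_state :=
  let: SwiState x r p q := s in
  if r == 0 then s else
  let alpha := dot r (p k) / dot (p k) (q k) in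
  let x' := x + alpha *: p k in
  let r' := r - alpha *: q k in
  let v := A *m r' in
  let P := window p k in
  let Q := window q k in
  let L := P^T *m Q in
  let lambda := invmx L *m (P^T *m v) in
  SwiState x' r'
    [eta p with k.+1 |-> r' - P *m lambda]
    [eta q with k.+1 |-> v - Q *m lambda].

Fixpoint swi (k : nat) : swi_state :=
  if k is k'.+1 then swi_step k' (swi k') else swi_init.

End SlidingWindow.

(* Main.v *)
Require Import Defs.
From mathcomp Require Import all_boot all_order all_algebra.
From mathcomp Require Import all_classical all_reals all_analysis.
From mathcomp Require Import complex ring lra zify.
Import Order.TTheory GRing.Theory Num.Theory.
Import numFieldNormedType.Exports.

Set Implicit Arguments.
Unset Strict Implicit.
Unset Printing Implicit Defensive.

Local Open Scope classical_set_scope.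
Local Open Scope ring_scope.

(** Put [B = A^-1] and [E r = r^T B r]. Semi-conjugacy of the window makes
    [r_(k+1)] orthogonal both to [p_k] and to [r_k], hence
    [E r_(k+1) = r_(k+1)^T B r_k]. With [c] the smallest eigenvalue of the
    symmetric part [H] of [B] and [rho] the spectral radius of its skew part [S],
    orthogonality gives
      [E r_(k+1) = r_(k+1)^T (H - c I) r_k + r_(k+1)^T S r_k],
    and two applications of the Cauchy-Schwarz inequality yield
      [(E r_(k+1))^2 <= (E r_(k+1) - d |r_(k+1)|^2) (E r_k - d |r_k|^2)]
    with [d = c - rho > 0]. As [E r] is at most a multiple of [|r|^2], [E r_k]
    decays geometrically. *)

(** * Spectral bounds: Rayleigh quotient of symmetric matrices, norm of skew ones *)

Section SpectralBounds.
Local Open Scope sesquilinear_scope.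

(** The rows of the diagonalizing matrix are eigenvectors in the row-vector convention of
    [eigenvalue]; they are nonzero because that matrix is invertible. *)
Lemma spectral_diag_eigenvalue (C : numClosedFieldType) (n : nat) (W : 'M[C]_n)
    (i : 'I_n) :
  W \is normalmx -> eigenvalue W (spectral_diag W 0 i).
Proof.
move=> /orthomx_spectralP W_eq; apply/eigenvalueP.
have Pu := spectral_unit W.
exists (row i (spectralmx W)).
  rewrite -row_mul {2}W_eq mulmxA mulmxA mulmxV // mul1mx.
  by rewrite row_mul row_diag_mx -scalemxAl -rowE.
apply/eqP => rowP0; have := mulmxV Pu => /(congr1 (row i)) /eqP.
rewrite row_mul rowP0 mul0mx => /eqP /rowP /(_ i).
by rewrite !mxE eqxx => /eqP; rewrite eq_sym oner_eq0.
Qed.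

(** [y] holds the coordinates of [x] in an orthonormal eigenbasis: the unitary change of basis
    preserves inner products and makes [W] diagonal. This serves both the symmetric and the skew
    case. *)
Lemma normalmx_diagonal_coords (C : numClosedFieldType) (n : nat) (W : 'M[C]_n)
    (x : 'cV[C]_n) (d := spectral_diag W) :
  W \is normalmx ->
  exists y : 'cV[C]_n,
    [/\ (x^t* *m x) 0 0 = \sum_i `|y i 0| ^+ 2,
        (x^t* *m (W *m x)) 0 0 = \sum_i d 0 i * `|y i 0| ^+ 2
      & ((W *m x)^t* *m (W *m x)) 0 0 = \sum_i `|d 0 i| ^+ 2 * `|y i 0| ^+ 2].
Proof.
move=> /orthomx_spectralP W_eq; exists (spectralmx W *m x).
have Pu := spectral_unitarymx W.
set P := spectralmx W in W_eq Pu *.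
have PtP : P^t* *m P = 1%:M.
  by rewrite -invmx_unitary // mulVmx // unitarymx_unit.
have PE u v : u^t* *m v = (P *m u)^t* *m (P *m v) :> 'M[C]_1.
  by rewrite trmx_mul map_mxM -mulmxA (mulmxA (P^t*)) PtP mul1mx.
have PW : P *m (W *m x) = diag_mx d *m (P *m x).
  by rewrite {1}W_eq !mulmxA mulmxV ?mul1mx // unitarymx_unit.
have entry i : (diag_mx d *m (P *m x)) i 0 = d 0 i * (P *m x) i 0.
  by rewrite mul_diag_mx !mxE.
split.
- rewrite PE mxE; apply: eq_bigr => i _.
  by rewrite 2!mxE normCK mulrC.
- rewrite PE PW mxE; apply: eq_bigr => i _.
  by rewrite entry 2!mxE normCK; ring.
- rewrite PE PW mxE; apply: eq_bigr => i _.
  by rewrite 2!mxE entry !normCK rmorphM; ring.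
Qed.

Section RealMatrices.
Variables (R : realType) (n : nat).
Implicit Types (W : 'M[R]_n) (x : 'cV[R]_n).

Lemma adjoint_map_real (p q : nat) (M : 'M[R]_(p, q)) :
  (map_mx (real_complex R) M)^t* = map_mx (real_complex R) M^T.
Proof. by apply/matrixP => i j; rewrite !mxE; exact: conjc_real. Qed.

(** Eigenvalues are roots of the characteristic polynomial, which splits, so the sum of the moduli
    of its roots is a bound. It makes the [inf] and [sup] in [lambda_min] and [spectral_radius]
    genuine bounds on the eigenvalues. *)
Lemma eigenvalue_normc_bound W :
  exists M : R, forall z : complex R,
    eigenvalue (map_mx (real_complex R) W) z ->
    ComplexField.Normc.normc z <= M.
Proof.
set Wc := map_mx _ W.
have [s char_eq] := closed_field_poly_normal (char_poly Wc).
exists (\sum_(w <- s) ComplexField.Normc.normc w) => z.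
rewrite eigenvalue_root_char char_eq (monicP (char_poly_monic _)) scale1r.
rewrite root_prod_XsubC => zs; rewrite (big_rem z) //= lerDl.
by apply: sumr_ge0 => -[u v] _; exact: sqrtr_ge0.
Qed.

Lemma lambda_min_rayleigh W x :
  W^T = W -> lambda_min W * dot x x <= dot x (W *m x).
Proof.
move=> W_sym; set toC := real_complex R.
have W_herm : map_mx toC W \is hermsymmx.
  by apply/is_hermitianmxP; rewrite expr0 scale1r adjoint_map_real W_sym.
have [y [xx xWx _]] :=
  normalmx_diagonal_coords (map_mx toC x) (hermitian_normalmx W_herm).
have bounded : has_lbound [set a : R | eigenvalue W a].
  have [M HM] := eigenvalue_normc_bound W.
  exists (- M) => a /= Wa; rewrite lerNl; apply: le_trans (ler_norm _) _.
  rewrite normrN; have := HM (toC a); rewrite eigenvalue_map => /(_ Wa).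
  by rewrite /= expr0n /= addr0 sqrtr_sqr.
move: xx xWx; rewrite !adjoint_map_real -!map_mxM ![map_mx _ _ _ _]mxE.
rewrite -/(dot x x) -/(dot x (W *m x)) => xx xWx.
rewrite -(@lecR R) rmorphM /= [X in _ * X]xx [X in _ <= X]xWx mulr_sumr.
apply: ler_sum => i _; apply: ler_wpM2r; first by rewrite exprn_ge0.
have d_real : spectral_diag (map_mx toC W) 0 i \is Num.real.
  exact: (mxOverP (hermitian_spectral_diag_real W_herm)).
have := spectral_diag_eigenvalue i (hermitian_normalmx W_herm).
rewrite -(RRe_real d_real) eigenvalue_map lecR => Wd.
exact: (ge_inf bounded).
Qed.

Lemma spectral_radius_ge0 W : 0 <= spectral_radius W.
Proof.
rewrite /spectral_radius; set S := (X in sup X).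
(* A set without a supremum gets the default value 0. *)
have [S_sup|/sup_out ->//] := pselect (has_sup S).
have [[a [z Wz za]] S_ub] := S_sup.
apply: (@le_trans _ _ a); last by apply: (ub_le_sup S_ub); exists z.
by rewrite -za; case: (z) => u v; exact: sqrtr_ge0.
Qed.

(** A real skew-symmetric matrix is normal over the complex numbers, so its Euclidean operator norm
    is controlled by the moduli of its eigenvalues. *)
Lemma skew_norm_bound W x :
  W^T = - W ->
  dot (W *m x) (W *m x) <= spectral_radius W ^+ 2 * dot x x.
Proof.
move=> W_skew; set toC := real_complex R.
have W_normal : map_mx toC W \is normalmx.
  by apply/normalmxP; rewrite adjoint_map_real W_skew map_mxN mulmxN mulNmx.
have [y [xx _ WxWx]] := normalmx_diagonal_coords (map_mx toC x) W_normal.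
have bounded : has_ubound [set ComplexField.Normc.normc z | z in
    [set z : complex R | eigenvalue (map_mx (real_complex R) W) z]].
  have [M HM] := eigenvalue_normc_bound W.
  by exists M => _ /= [z Wz <-]; exact: HM.
move: xx WxWx; rewrite -!map_mxM !adjoint_map_real -!map_mxM ![map_mx _ _ _ _]mxE.
rewrite -/(dot x x) -/(dot (W *m x) (W *m x)) => xx WxWx.
rewrite -(@lecR R) rmorphM /= [X in _ * X]xx [X in X <= _]WxWx mulr_sumr.
apply: ler_sum => i _; apply: ler_wpM2r; first by rewrite exprn_ge0.
rewrite rmorphXn /= ler_pXn2r ?nnegrE //; last first.
  by rewrite (@lecR R 0) spectral_radius_ge0.
rewrite -[X in X <= _]/((ComplexField.Normc.normc _)%:C%C) lecR.
apply: (ub_le_sup bounded) => /=; exists (spectral_diag (map_mx toC W) 0 i) => //.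
exact: spectral_diag_eigenvalue.
Qed.

End RealMatrices.

End SpectralBounds.

(** * Contraction of the quadratic form for orthogonal pairs *)

Section Contraction.
Variables (R : realType) (n : nat).
Implicit Types (W B M : 'M[R]_n) (u v x r s : 'cV[R]_n).

Lemma dotC u v : dot u v = dot v u.
Proof. by rewrite /dot -(trmxK v) -trmx_mul [LHS]mxE trmxK. Qed.

Lemma dotDr u v x : dot u (v + x) = dot u v + dot u x.
Proof. by rewrite /dot mulmxDr mxE. Qed.

Lemma dotBr u v x : dot u (v - x) = dot u v - dot u x.
Proof. by rewrite /dot mulmxBr !mxE. Qed.

Lemma dotZr (a : R) u v : dot u (a *: v) = a * dot u v.
Proof. by rewrite /dot -scalemxAr mxE. Qed.

Lemma dotBl u v x : dot (u - v) x = dot u x - dot v x.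
Proof. by rewrite dotC dotBr !(dotC x). Qed.

Lemma dotZl (a : R) u v : dot (a *: u) v = a * dot u v.
Proof. by rewrite dotC dotZr dotC. Qed.

Lemma dot0l u : dot 0 u = 0.
Proof. by rewrite /dot trmx0 mul0mx mxE. Qed.

Lemma dot0r u : dot u 0 = 0.
Proof. by rewrite dotC dot0l. Qed.

Lemma dot_mulmxl (k : nat) (M : 'M[R]_(n, k)) (u : 'cV[R]_k) v :
  dot (M *m u) v = dot u (M^T *m v).
Proof. by rewrite /dot trmx_mul mulmxA. Qed.

Lemma dotE u v : dot u v = \sum_i u i 0 * v i 0.
Proof. by rewrite /dot mxE; apply: eq_bigr => i _; rewrite mxE. Qed.

Lemma dot_ge0 u : 0 <= dot u u.
Proof. by rewrite dotE sumr_ge0 // => i _; rewrite -expr2 sqr_ge0. Qed.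

Lemma sqr_coord_le_dot u i : u i 0 ^+ 2 <= dot u u.
Proof.
rewrite dotE (bigD1 i) //= -expr2 lerDl sumr_ge0 // => j _.
by rewrite -expr2 sqr_ge0.
Qed.

Lemma dot_eq0 u : (dot u u == 0) = (u == 0).
Proof.
apply/eqP/eqP => [u0|->]; last exact: dot0l.
apply/colP => i; rewrite mxE; apply/eqP; rewrite -sqrf_eq0.
by apply/eqP/le_anti; rewrite sqr_ge0 andbT -u0 sqr_coord_le_dot.
Qed.

Lemma quadratic_form_bound W :
  exists2 K : R, 0 <= K & forall x, dot x (W *m x) <= K * dot x x.
Proof.
exists (\sum_i \sum_j `|W i j|).
  by apply: sumr_ge0 => i _; apply: sumr_ge0.
move=> x; rewrite dotE mulr_suml; apply: ler_sum => i _.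
rewrite mxE mulr_sumr mulr_suml; apply: ler_sum => j _.
apply: le_trans (ler_norm _) _; rewrite !normrM mulrCA.
apply: ler_wpM2l => //.
have := sqr_coord_le_dot x i; have := sqr_coord_le_dot x j.
rewrite -(real_normK (num_real (x i 0))) -(real_normK (num_real (x j 0))).
by have := sqr_ge0 (`|x i 0| - `|x j 0|); nra.
Qed.

Lemma psd_cauchy_schwarz M u v :
  M^T = M -> (forall x, 0 <= dot x (M *m x)) ->
  dot u (M *m v) ^+ 2 <= dot u (M *m u) * dot v (M *m v).
Proof.
move=> M_sym M_psd.
have sym : dot v (M *m u) = dot u (M *m v) by rewrite -{1}M_sym -dot_mulmxl dotC.
have expand (a b : R) : 0 <= a ^+ 2 * dot u (M *m u)
    - 2 * a * b * dot u (M *m v) + b ^+ 2 * dot v (M *m v).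
  have := M_psd (a *: u - b *: v).
  rewrite mulmxBr -!scalemxAr !dotBl !dotBr !dotZl !dotZr sym.
  by congr (0 <= _); ring.
have uu := M_psd u; have vv := M_psd v.
(* With [a], [X], [Y] as named below, the three instances give [Y (XY - a^2) >= 0],
   [X (XY - a^2) >= 0] and, when [X = Y = 0], [- 2 a^2 >= 0]. They settle the cases [Y > 0], [X > 0]
   and both zero; the form may be degenerate. *)
move: (expand (dot v (M *m v)) (dot u (M *m v))).
move: (expand (dot u (M *m v)) (dot u (M *m u))).
move: (expand (dot u (M *m v)) 1).
move: uu vv; move: (dot u (M *m v)) (dot u (M *m u)) (dot v (M *m v)) => a X Y.
move=> X0 Y0 E1 E2 E3.
case: (ltrP 0 Y) => [Ypos|Yle].
  by rewrite -(ler_pM2l Ypos); nra.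
have {Yle Y0} Y0 : Y = 0 by lra.
case: (ltrP 0 X) => [Xpos|Xle].
  by rewrite -(ler_pM2l Xpos); nra.
have {Xle X0} X0 : X = 0 by lra.
by subst; nra.
Qed.

Lemma sym_part_form B x : dot x (sym_part B *m x) = dot x (B *m x).
Proof.
rewrite /sym_part -scalemxAl mulmxDl dotZr dotDr -dot_mulmxl dotC.
by field.
Qed.

Lemma sym_partT B : (sym_part B)^T = sym_part B.
Proof. by rewrite /sym_part linearZ /= linearD /= trmxK addrC. Qed.

Lemma skew_partT B : (skew_part B)^T = - skew_part B.
Proof. by rewrite /skew_part linearZ /= linearB /= trmxK -scalerN opprB. Qed.

Lemma sym_skewK B : sym_part B + skew_part B = B.
Proof.
by apply/matrixP => i j; rewrite !mxE; field.
Qed.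

Lemma lambda_min_le_form B x :
  lambda_min (sym_part B) * dot x x <= dot x (B *m x).
Proof. by rewrite -(sym_part_form B) lambda_min_rayleigh // sym_partT. Qed.

(* Orthogonality of [r] and [s] allows [sym_part B] to be replaced by the
   positive semidefinite [sym_part B - lambda_min] in the cross term, and the
   Cauchy-Schwarz inequality is applied to the symmetric and skew parts
   separately. *)
Lemma orthogonal_form_contraction B r s :
  let gap := lambda_min (sym_part B) - spectral_radius (skew_part B) in
  dot s r = 0 -> dot s (B *m s) = dot s (B *m r) ->
  dot s (B *m s) ^+ 2 <= (dot s (B *m s) - gap * dot s s)
                         * (dot r (B *m r) - gap * dot r r).
Proof.
set c := lambda_min _; set rho := spectral_radius _ => gap sr sBs.
pose M := sym_part B - c%:M.
have Mform x : dot x (M *m x) = dot x (B *m x) - c * dot x x.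
  by rewrite mulmxBl mul_scalar_mx dotBr dotZr sym_part_form.
have M_psd x : 0 <= dot x (M *m x) by rewrite Mform subr_ge0 lambda_min_le_form.
have M_sym : M^T = M by rewrite /M linearB /= sym_partT tr_scalar_mx.
have cs_sym := psd_cauchy_schwarz s r M_sym M_psd.
have cross : dot s (B *m r) = dot s (M *m r) + dot s (skew_part B *m r).
  rewrite -{1}(sym_skewK B) mulmxDl dotDr /M mulmxBl mul_scalar_mx dotBr dotZr.
  by rewrite sr mulr0 subr0.
have cs_skew : dot s (skew_part B *m r) ^+ 2 <= rho ^+ 2 * (dot s s * dot r r).
  have one_psd x : 0 <= dot x (1%:M *m x) by rewrite mul1mx dot_ge0.
  have := psd_cauchy_schwarz s (skew_part B *m r) (trmx1 _ _) one_psd.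
  rewrite !mul1mx => /le_trans; apply; rewrite mulrCA.
  apply: ler_wpM2l; first exact: dot_ge0.
  exact: skew_norm_bound (skew_partT B).
have rho0 : 0 <= rho by exact: spectral_radius_ge0.
have := dot_ge0 s; have := dot_ge0 r; have := M_psd s; have := M_psd r.
rewrite {1}sBs cross.
have -> : dot s (B *m s) = dot s (M *m s) + c * dot s s by rewrite Mform; ring.
have -> : dot r (B *m r) = dot r (M *m r) + c * dot r r by rewrite Mform; ring.
rewrite /gap; move: cs_sym cs_skew.
move: (dot s (M *m r)) (dot s (skew_part B *m r)) (dot s (M *m s))
  (dot r (M *m r)) (dot s s) (dot r r) => a d X Y ss rr.
move=> aXY dss Y0 X0 rr0 ss0.
(* The goal reads [(a + d)^2 <= (X + rho ss) (Y + rho rr)]; [aXY] and [dss] bound the two squares,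
   which leaves the cross terms. *)
suff ad : 2 * (a * d) <= rho * (X * rr + Y * ss) by nra.
have [ad0|ad0] := lerP (a * d) 0.
  apply: (@le_trans _ _ 0); first by lra.
  by rewrite mulr_ge0 // addr_ge0 // mulr_ge0.
(* Both sides are nonnegative here. After squaring, multiplying the two Cauchy-Schwarz bounds
   reduces the claim to the arithmetic-geometric mean inequality. *)
rewrite -ler_sqr ?nnegrE; last by rewrite mulr_ge0 // addr_ge0 // mulr_ge0.
  apply: (@le_trans _ _ (4 * ((X * Y) * (rho ^+ 2 * (ss * rr))))).
    have -> : (2 * (a * d)) ^+ 2 = 4 * (a ^+ 2 * d ^+ 2) by ring.
    by rewrite ler_pM2l // ler_pM // sqr_ge0.
  rewrite -subr_ge0.
  have -> : (rho * (X * rr + Y * ss)) ^+ 2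
     - 4 * (X * Y * (rho ^+ 2 * (ss * rr))) = (rho * (X * rr - Y * ss)) ^+ 2.
    by ring.
  exact: sqr_ge0.
by lra.
Qed.

Lemma form_geometric_decay B :
  lambda_min (sym_part B) > spectral_radius (skew_part B) ->
  exists theta : R, [/\ 0 <= theta, theta < 1 & forall r s : 'cV[R]_n,
    dot s r = 0 -> dot s (B *m s) = dot s (B *m r) ->
    dot s (B *m s) <= theta * dot r (B *m r)].
Proof.
move=> gap_gt0; have [K K0 HK] := quadratic_form_bound B.
set g := lambda_min (sym_part B) - spectral_radius (skew_part B).
have g0 : 0 < g by rewrite subr_gt0.
have gK : 0 < g + K by rewrite ltr_wpDr.
(* Since the form is at most [(g + K) |x|^2], subtracting [g |x|^2] removes at least the fraction
   [g / (g + K)] of it. The denominator is positive even if [K = 0]. *)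
pose t := K / (g + K).
have t0 : 0 <= t by rewrite divr_ge0 // ltW.
have t1 : t < 1 by rewrite ltr_pdivrMr // mul1r ltrDr.
have lambda0 : 0 < lambda_min (sym_part B).
  exact: le_lt_trans (spectral_radius_ge0 _) gap_gt0.
have form0 x : 0 <= dot x (B *m x).
  by apply: le_trans (lambda_min_le_form _ _); rewrite mulr_ge0 ?dot_ge0 // ltW.
have defect x : dot x (B *m x) - g * dot x x <= t * dot x (B *m x).
  have -> : t = 1 - g / (g + K) by rewrite /t; field; rewrite gt_eqF.
  rewrite [leRHS]mulrBl mul1r lerD2l lerN2 mulrAC ler_pdivrMr // -mulrA.
  by rewrite ler_pM2l //; have := HK x; have := dot_ge0 x; nra.
have defect0 x : 0 <= dot x (B *m x) - g * dot x x.
  have := lambda_min_le_form B x; have := dot_ge0 x.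
  have := spectral_radius_ge0 (skew_part B).
  by rewrite /g; nra.
(* Each factor of the contraction contributes one [t]; one copy of the form at [s] then cancels,
   unless it is zero. *)
exists (t ^+ 2); split; rewrite ?sqr_ge0 //; first by rewrite expr_lt1.
move=> r s sr sBs; have := orthogonal_form_contraction sr sBs.
rewrite -/g => main.
have {main} : dot s (B *m s) ^+ 2
    <= (t * dot s (B *m s)) * (t * dot r (B *m r)).
  by apply: le_trans main _; apply: ler_pM.
have := form0 s; rewrite le_eqVlt => /predU1P[<- _|E0].
  by rewrite mulr_ge0 // sqr_ge0.
rewrite (_ : _ * _ = dot s (B *m s) * (t ^+ 2 * dot r (B *m r))); last by ring.
by rewrite expr2 ler_pM2l.
Qed.

End Contraction.

(** * Orthogonality relations maintained by the iteration *)

Section Iteration.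
Variables (R : realType) (n m : nat) (A : 'M[R]_n) (b : 'cV[R]_n).
Hypothesis A_posdef : posdefmx A.

Lemma posdef_form_gt0 (x : 'cV[R]_n) : x != 0 -> 0 < dot x (A *m x).
Proof. by move=> x0; rewrite /dot mulmxA A_posdef. Qed.

Lemma posdef_unitmx : A \in unitmx.
Proof.
rewrite unitmxE unitfE; apply/det0P => -[v v0 vA0].
have := A_posdef (x := v^T); rewrite trmxK vA0 mul0mx mxE ltxx.
suff -> : v^T != 0 by move=> /(_ isT).
by apply: contra v0 => /eqP/(congr1 trmx); rewrite trmxK trmx0 => /eqP.
Qed.

Lemma mul_window_tr (u : nat -> 'cV[R]_n) k (w : 'cV[R]_n) j :
  ((window m u k)^T *m w) j 0 = dot (u (k - minn k m + j)%N) w.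
Proof. by rewrite dotE mxE; apply: eq_bigr => i _; rewrite !mxE. Qed.

(** The condition [i <= k <= i + m] selects exactly the indices from [k - minn k m] to [k], without
    truncated subtraction. *)
Lemma window_orthogonal (u : nat -> 'cV[R]_n) k (w : 'cV[R]_n) :
  (forall i, (i <= k <= i + m)%N -> dot (u i) w = 0) <->
  (window m u k)^T *m w = 0.
Proof.
split=> [uw|uw i /andP[ik ki]].
  apply/colP => j; rewrite mul_window_tr mxE uw //.
  by have := ltn_ord j; lia.
have lt_i : (i - (k - minn k m) < (minn k m).+1)%N by lia.
have := mul_window_tr u w (Ordinal lt_i); rewrite uw mxE /= subnKC //.
by lia.
Qed.

(** Semi-conjugacy kills the entries above the diagonal, and the diagonal entries [p_i^T A p_i] are
    positive, so the determinant is nonzero. *)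
Lemma window_gram_unitmx (p q : nat -> 'cV[R]_n) k :
  (forall i, (i <= k)%N -> q i = A *m p i) ->
  (forall i j, (i < j <= k)%N -> (j <= i + m.+1)%N -> dot (p i) (q j) = 0) ->
  (forall i, (i <= k)%N -> p i != 0) ->
  (window m p k)^T *m window m q k \in unitmx.
Proof.
move=> q_eq conj p0; rewrite unitmxE unitfE.
have entry i j : ((window m p k)^T *m window m q k) i j =
    dot (p (k - minn k m + i)%N) (q (k - minn k m + j)%N).
  by rewrite dotE mxE; apply: eq_bigr => l _; rewrite !mxE.
rewrite det_trig; last first.
  apply/is_trig_mxP => i j lt_ij; rewrite entry conj //.
    by have := ltn_ord j; lia.
  by have := ltn_ord j; lia.
apply/prodf_neq0 => i _; rewrite entry q_eq; last by have := ltn_ord i; lia.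
by rewrite gt_eqF // posdef_form_gt0 // p0 //; have := ltn_ord i; lia.
Qed.

(* The last clause encodes that [p_k - r_k] is a combination of the window
   [p_(k-1-m_(k-1)), ..., p_(k-1)]. *)
Definition swi_invariant (k : nat) (s : swi_state R n) : Prop :=
  let: SwiState x r p q := s in
  [/\ forall i, (i <= k)%N -> q i = A *m p i,
      forall i j, (i < j <= k)%N -> (j <= i + m.+1)%N -> dot (p i) (q j) = 0,
      forall i, (i <= k)%N -> p i != 0,
      forall i, (i < k <= i + m.+1)%N -> dot (p i) r = 0
    & forall w, (forall i, (i < k <= i + m.+1)%N -> dot (p i) w = 0) ->
        dot (p k) w = dot r w].

Lemma swi_step_invariant k (s : swi_state R n) (s' := swi_step A m k s) :
  swi_invariant k s -> swi_r s != 0 -> A *m swi_x s = b - swi_r s ->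
  [/\ A *m swi_x s' = b - swi_r s',
      dot (swi_r s') (swi_r s) = 0,
      dot (swi_r s') (invmx A *m swi_r s') = dot (swi_r s') (invmx A *m swi_r s)
    & swi_r s' != 0 -> swi_invariant k.+1 s'].
Proof.
rewrite {}/s'; case: s => x r p q [q_eq conj p0 pr dir] /= r0 Ax.
rewrite (negPf r0) /=.
set alpha := dot r (p k) / _; set r' := r - alpha *: q k.
set v := A *m r'; set P := window m p k; set Q := window m q k.
set lambda := invmx (P^T *m Q) *m (P^T *m v).
have pq_gt0 i : (i <= k)%N -> 0 < dot (p i) (q i).
  by move=> ik; rewrite q_eq // posdef_form_gt0 // p0.
(* For [i = k] this is the choice of [alpha]; for earlier [i] both [r] and [q k] are already
   orthogonal to [p i]. *)
have pr' i : (i <= k <= i + m.+1)%N -> dot (p i) r' = 0.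
  move=> /andP[]; rewrite leq_eqVlt => /predU1P[->|ik] ki.
    rewrite /r' dotBr dotZr /alpha divfK ?gt_eqF ?pq_gt0 //.
    by rewrite dotC subrr.
  by rewrite /r' dotBr dotZr pr ?ik // conj ?ik ?leqnn // mulr0 subr0.
(* As [r'] is orthogonal to the previous window, the last clause of the invariant lets [p k] stand
   for [r]. *)
have r'r : dot r' r = 0.
  rewrite dotC -dir => [|i /andP[ik ki]]; first by rewrite pr' //; lia.
  by rewrite pr' //; lia.
have Bq : invmx A *m q k = p k by rewrite q_eq // mulKmx // posdef_unitmx.
split=> //.
- by rewrite mulmxDr Ax -scalemxAr -q_eq // /r' opprB addrA addrAC.
(* The two images under [invmx A] differ by a multiple of [p k], which is orthogonal to [r']. *)
- - have -> : invmx A *m r' = invmx A *m r - alpha *: p k.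
    by rewrite /r' mulmxBr -scalemxAr Bq.
  by rewrite dotBr dotZr (dotC _ (p k)) pr' ?mulr0 ?subr0 //; lia.
move=> r'0.
have Pr' : P^T *m r' = 0 by apply/window_orthogonal => i ?; rewrite pr' //; lia.
(* This is the linear system defining [lambda]: the new [q] is orthogonal to every direction of the
   window. *)
have Qv : P^T *m (v - Q *m lambda) = 0.
  rewrite mulmxBr (mulmxA _ Q) mulKVmx ?subrr //.
  exact: window_gram_unitmx.
have QAP : Q = A *m P.
  apply/matrixP => i j; rewrite !mxE q_eq; last by have := ltn_ord j; lia.
  by rewrite mxE; apply: eq_bigr => l _; rewrite !mxE.
have new_dir w : P^T *m w = 0 -> dot (r' - P *m lambda) w = dot r' w.
  by move=> Pw; rewrite dotBl dot_mulmxl Pw dot0r subr0.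
split=> /=.
- move=> i; rewrite leq_eqVlt => /predU1P[->|ik].
    by rewrite eqxx QAP -mulmxA -mulmxBr.
  by rewrite ltn_eqF // q_eq.
- move=> i j /andP[ij jk] jim; rewrite (ltn_eqF (leq_trans ij jk)).
  case: eqVneq => [jk1|jk1]; last by apply: conj => //; lia.
  by have /window_orthogonal -> // := Qv; lia.
- move=> i; rewrite leq_eqVlt => /predU1P[->|ik].
    (* The correction [P *m lambda] is orthogonal to [r'], so the new direction has inner product
       [|r'|^2] with [r'] and cannot vanish. *)
    rewrite eqxx; apply: contra r'0 => /eqP p'0.
    by rewrite -dot_eq0 -new_dir // p'0 dot0l.
  by rewrite ltn_eqF // p0.
- by move=> i /andP[ik ki]; rewrite ltn_eqF // pr' //; lia.
- move=> w pw; rewrite eqxx new_dir //; apply/window_orthogonal => i /andP[ik ki].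
  by have := pw i; rewrite ltn_eqF ?ltnS // ik; apply; lia.
Qed.

Lemma swi_stationary k (s : swi_state R n) : swi_r s = 0 -> swi_step A m k s = s.
Proof. by case: s => x r p q /= ->; rewrite eqxx. Qed.

(** The invariant is guarded by a nonzero residual: when the residual vanishes so does the new
    direction. The residual identity survives stopping. *)
Lemma swi_invariant_holds k (s := swi A b m k) :
  A *m swi_x s = b - swi_r s /\ (swi_r s != 0 -> swi_invariant k s).
Proof.
rewrite {}/s; elim: k => [|k [Ax IH]] /=.
  split=> [|b0]; first by rewrite mulmx0 subrr.
  by split=> // i j; lia.
have [r0|r0] := eqVneq (swi_r (swi A b m k)) 0.
  by rewrite swi_stationary // r0 eqxx; split; rewrite // Ax r0.
by have [] := swi_step_invariant (IH r0) r0 Ax.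
Qed.

Lemma swi_form_decay k (theta : R) :
  (forall r s : 'cV[R]_n, dot s r = 0 ->
     dot s (invmx A *m s) = dot s (invmx A *m r) ->
     dot s (invmx A *m s) <= theta * dot r (invmx A *m r)) ->
  0 <= theta ->
  dot (swi_r (swi A b m k)) (invmx A *m swi_r (swi A b m k))
    <= theta ^+ k * dot b (invmx A *m b).
Proof.
move=> decay theta0; elim: k => [|k IH] /=; first by rewrite mul1r.
have [Ax inv] := swi_invariant_holds k.
rewrite exprS -mulrA; apply: le_trans (ler_wpM2l theta0 IH).
have [r0|r0] := eqVneq (swi_r (swi A b m k)) 0.
  by rewrite swi_stationary // r0 !dot0l mulr0.
by have [_ + + _] := swi_step_invariant (inv r0) r0 Ax; exact: decay.
Qed.

Lemma swi_solution_error k :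
  swi_x (swi A b m k) = invmx A *m b - invmx A *m swi_r (swi A b m k).
Proof.
have [Ax _] := swi_invariant_holds k.
by rewrite -mulmxBr -Ax mulKmx // posdef_unitmx.
Qed.

End Iteration.

(** * Convergence of the iterates *)

Lemma cvg_mx_coord (R : realType) (p q : nat) (u : nat -> 'M[R]_(p, q))
    (l : 'M[R]_(p, q)) :
  (forall i j, (fun k => u k i j) @ \oo --> l i j) -> u @ \oo --> l.
Proof.
move=> ul; apply/cvg_ballP => e e0.
suff : \forall k \near \oo, forall ij : 'I_p * 'I_q,
    ball (l ij.1 ij.2) e (u k ij.1 ij.2).
  by apply: filterS => k uk; split=> // i j; exact: (uk (i, j)).
apply: filter_forall => -[i j] /=.
by have /cvg_ballP := ul i j; exact.
Qed.

Theorem theorem3p1 (R : realType) (n m : nat) (A : 'M[R]_n) (b : 'cV[R]_n)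
  (A_posdef : posdefmx A)
  (gap : lambda_min (sym_part (invmx A)) > spectral_radius (skew_part (invmx A))) :
  exists xstar : 'cV[R]_n,
    [/\ unique (fun y : 'cV[R]_n => A *m y = b) xstar,
        (fun k : nat => swi_x (swi A b m k)) @ \oo --> xstar
      & forall k : nat, swi_r (swi A b m k) = 0 -> swi_x (swi A b m k) = xstar].
Proof.
have A_unit := posdef_unitmx A_posdef.
exists (invmx A *m b); split.
- by split=> [|y <-]; rewrite ?mulKVmx ?mulKmx.
- have [theta [theta0 theta1 decay]] := form_geometric_decay gap.
  set c := lambda_min (sym_part (invmx A)).
  have c0 : 0 < c := le_lt_trans (spectral_radius_ge0 _) gap.
  set r := fun k => swi_r (swi A b m k).
  have rr_cvg : (fun k => dot (r k) (r k)) @ \oo --> (0 : R).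
    (* The form at [r k] is at least [c |r k|^2] and at most [theta^k] times its value at [b];
       dividing by [c] gives this bound. *)
    pose g := geometric (c^-1 * dot b (invmx A *m b)) theta.
    apply: (@squeeze_cvgr _ _ _ _ (cst 0) g).
    + near=> k; rewrite dot_ge0 /= -(ler_pM2l c0).
      apply: le_trans (lambda_min_le_form _ _) _.
      apply: le_trans (swi_form_decay m b A_posdef k decay theta0) _.
      by rewrite /g /geometric /= !mulrA divff ?gt_eqF // mul1r mulrC.
    + exact: cvg_cst.
    + by apply: cvg_geometric; rewrite ger0_norm.
  have r_cvg i : (fun k => r k i 0) @ \oo --> (0 : R).
    have sq_cvg : (fun k => r k i 0 ^+ 2) @ \oo --> (0 : R).
      apply: (@squeeze_cvgr _ _ _ _ (cst 0) (fun k => dot (r k) (r k))) => //.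
        by near=> k; rewrite sqr_ge0 sqr_coord_le_dot.
      exact: cvg_cst.
    apply/cvgr0Pnorm_lt => e e0.
    have /cvgr0Pnorm_lt /(_ (e ^+ 2) (exprn_gt0 _ e0)) := sq_cvg.
    apply: filterS => k; rewrite normrX ltr_pXn2r ?nnegrE //.
    exact: ltW.
  apply: cvg_mx_coord => i j; rewrite ord1.
  (* Each coordinate of the error is a fixed finite linear combination of residual coordinates, all
     of which tend to 0. *)
  rewrite (_ : (fun k => _) = fun k =>
      (invmx A *m b) i 0 - \sum_l invmx A i l * r k l 0); last first.
    by apply/funext => k; rewrite swi_solution_error // !mxE.
  rewrite -[X in _ --> X]subr0; apply: cvgB; first exact: cvg_cst.
  rewrite [X in _ --> X](_ : 0 = \sum_l invmx A i l * 0); last first.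
    by rewrite big1 // => l _; rewrite mulr0.
  apply: cvg_big => [|l _]; first exact: add_continuous.
  by apply: cvgM; [exact: cvg_cst | exact: r_cvg].
- by move=> k r0; rewrite swi_solution_error // r0 mulmx0 subr0.
Unshelve. all: by end_near.
Qed.
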